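(* Let $R$ be a ring. The assignment of a twisted group ring to a group action, $(\theta: G\to\mathrm{Aut}_{\mathrm{Ring}}(R))\mapsto (R\to R_\theta[G])$, assembles into a functor $$\mathrm{twist}_R:\mathrm{Grp}/\mathrm{Aut}_{\mathrm{Ring}}(R)\to R/\mathrm{Ring},$$ which is referred to as twistification.
   Context: Rings are associative and unital, and ring homomorphisms are unital. $\mathrm{Aut}_{\mathrm{Ring}}(R)$ is the group of ring automorphisms of $R$ under composition. $\mathrm{Grp}/\mathrm{Aut}_{\mathrm{Ring}}(R)$ is the slice category: objects are group homomorphisms $\theta: G\to \mathrm{Aut}_{\mathrm{Ring}}(R)$, and a morphism from $\theta: G\to \mathrm{Aut}_{\mathrm{Ring}}(R)$ to $\psi: K \to \mathrm{Aut}_{\mathrm{Ring}}(R)$ is a group homomorphism $j: G\to K$ with $\psi\circ j=\theta$. $R/\mathrm{Ring}$ is the slice category of rings under $R$: objects are ring homomorphisms $f: R\to S$, and a morphism from $f: R\to S$ to $g: R\to T$ is a ring homomorphism $h: S\to T$ with $h\circ f = g$. Twisted group ring: for $\theta: G\to \mathrm{Aut}_{\mathrm{Ring}}(R)$, writing $\theta_g=\theta(g)$, the ring $R_\theta[G]$ has the same elements as the group ring $R[G]$ (finite formal sums of terms $rg$ with $r\in R$, $g\in G$, with the usual addition), but its multiplication is twisted by $\theta$: it is the additive extension of $(r_1g_1)\cdot(r_2g_2) := r_1\theta_{g_1}(r_2)\,g_1g_2$. It comes equipped with the natural ring homomorphism $R\to R_\theta[G]$, $r\mapsto r1_G$, where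 $1_G$ is the identity of $G$. *)

(* Defs.v *)
From HB Require Import structures.
From mathcomp Require Import all_boot all_algebra.
From mathcomp Require Import finmap.
From mathcomp Require Import boolp.
From mathcomp.multinomials Require Import monalg.

Set Implicit Arguments.
Unset Strict Implicit.
Unset Printing Implicit Defensive.

Import GRing.Theory.
Local Open Scope ring_scope.

(* [compm f g] is f after g. *)

Record category := Category {
  cobj :> Type;
  chom : cobj -> cobj -> Type;
  idm : forall a, chom a a;
  compm : forall a b c, chom b c -> chom a b -> chom a c;
  compmA : forall a b c d (f : chom c d) (g : chom b c) (h : chom a b),
    compm f (compm g h) = compm (compm f g) h;
  comp1m : forall a b (f : chom a b), compm (idm b) f = f;
  compm1 : forall a b (f : chom a b), compm f (idm a) = f }.
Arguments chom {_} _ _.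
Arguments idm {_} _.
Arguments compm {_ _ _ _} _ _.

Record is_functor (C D : category) (F0 : C -> D)
    (F1 : forall a b : C, chom a b -> chom (F0 a) (F0 b)) : Prop := IsFunctor {
  functor_id : forall a : C, F1 a a (idm a) = idm (F0 a);
  functor_comp : forall (a b c : C) (f : chom b c) (g : chom a b),
    F1 a c (compm f g) = compm (F1 b c f) (F1 a b g) }.

Record slice_obj (C : category) (X : C) := SliceObj {
  slice_dom : C;
  slice_map : chom slice_dom X }.

Record slice_hom (C : category) (X : C) (a b : slice_obj X) := SliceHom {
  slice_mor : chom (slice_dom a) (slice_dom b);
  slice_comm : compm (slice_map b) slice_mor = slice_map a }.

Lemma slice_hom_eq (C : category) (X : C) (a b : slice_obj X)
  (f g : slice_hom a b) : slice_mor f = slice_mor g -> f = g.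
Proof.
case: f g => [f fP] [g gP] /= fg; case: _ / fg gP => gP.
by congr SliceHom; apply: Prop_irrelevance.
Qed.

Fact slice_id_subproof (C : category) (X : C) (a : slice_obj X) :
  compm (slice_map a) (idm (slice_dom a)) = slice_map a.
Proof. exact: compm1. Qed.

Fact slice_comp_subproof (C : category) (X : C) (a b c : slice_obj X)
  (f : slice_hom b c) (g : slice_hom a b) :
  compm (slice_map c) (compm (slice_mor f) (slice_mor g)) = slice_map a.
Proof. by rewrite compmA !slice_comm. Qed.

Definition slice (C : category) (X : C) : category.
Proof.
refine (@Category (slice_obj X) (@slice_hom C X)
  (fun a => SliceHom (slice_id_subproof a))
  (fun a b c f g => SliceHom (slice_comp_subproof f g)) _ _ _) => *;
  apply: slice_hom_eq; [exact: compmA|exact: comp1m|exact: compm1].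
Defined.

Arguments slice : clear implicits.

Record coslice_obj (C : category) (X : C) := CosliceObj {
  coslice_cod : C;
  coslice_map : chom X coslice_cod }.

Record coslice_hom (C : category) (X : C) (a b : coslice_obj X) := CosliceHom {
  coslice_mor : chom (coslice_cod a) (coslice_cod b);
  coslice_comm : compm coslice_mor (coslice_map a) = coslice_map b }.

Lemma coslice_hom_eq (C : category) (X : C) (a b : coslice_obj X)
  (f g : coslice_hom a b) : coslice_mor f = coslice_mor g -> f = g.
Proof.
case: f g => [f fP] [g gP] /= fg; case: _ / fg gP => gP.
by congr CosliceHom; apply: Prop_irrelevance.
Qed.

Fact coslice_id_subproof (C : category) (X : C) (a : coslice_obj X) :
  compm (idm (coslice_cod a)) (coslice_map a) = coslice_map a.
Proof. exact: comp1m. Qed.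

Fact coslice_comp_subproof (C : category) (X : C) (a b c : coslice_obj X)
  (f : coslice_hom b c) (g : coslice_hom a b) :
  compm (compm (coslice_mor f) (coslice_mor g)) (coslice_map a) = coslice_map c.
Proof. by rewrite -compmA !coslice_comm. Qed.

Definition coslice (C : category) (X : C) : category.
Proof.
refine (@Category (coslice_obj X) (@coslice_hom C X)
  (fun a => CosliceHom (coslice_id_subproof a))
  (fun a b c f g => CosliceHom (coslice_comp_subproof f g)) _ _ _) => *;
  apply: coslice_hom_eq; [exact: compmA|exact: comp1m|exact: compm1].
Defined.

Arguments coslice : clear implicits.

Notation group_hom := monoid.UMagmaMorphism.type.

Lemma group_hom_eq (G K : groupType) (f g : group_hom G K) : f =1 g -> f = g.
Proof.
case: f g => [f [[f1] [fM]]] [g [[g1] [gM]]] /= /funext fg.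
case: _ / fg g1 gM => g1 gM.
by rewrite (Prop_irrelevance f1 g1) (Prop_irrelevance fM gM).
Qed.

(* Objects are arbitrary, possibly infinite, groups. *)
Definition Grp : category.
Proof.
refine (@Category groupType (fun G K => group_hom G K)
  (fun G => (@idfun G : group_hom G G))
  (fun G H K f g => (f \o g : group_hom G K)) _ _ _) => *;
  exact: group_hom_eq.
Defined.

Lemma rmorphism_eq (R S : pzRingType) (f g : {rmorphism R -> S}) :
  f =1 g -> f = g.
Proof.
case: f g => [f [[fD] [fM]]] [g [[gD] [gM]]] /= /funext fg.
case: _ / fg gD gM => gD gM.
case: fD gD fM gM => [f0 fD] [g0 gD] [f1 fM] [g1 gM].
by rewrite (Prop_irrelevance f0 g0) (Prop_irrelevance fD gD)
           (Prop_irrelevance f1 g1) (Prop_irrelevance fM gM).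
Qed.

(* [pzRingType] is the type of all unital rings, the zero ring included. *)
Definition Ring : category.
Proof.
refine (@Category pzRingType (fun R S => {rmorphism R -> S})
  (fun R => (@idfun R : {rmorphism R -> R}))
  (fun R S T f g => (f \o g : {rmorphism R -> T})) _ _ _) => *;
  exact: rmorphism_eq.
Defined.

Record ring_aut (R : pzRingType) := RingAut {
  ring_aut_mor :> {rmorphism R -> R};
  ring_aut_bij : bijective ring_aut_mor }.

HB.instance Definition _ (R : pzRingType) := gen_eqMixin (ring_aut R).
HB.instance Definition _ (R : pzRingType) := gen_choiceMixin (ring_aut R).

Lemma ring_aut_eq (R : pzRingType) (a b : ring_aut R) : a =1 b -> a = b.
Proof.
case: a b => [a aP] [b bP] /= /rmorphism_eq ab; case: _ / ab bP => bP.
by congr RingAut; apply: Prop_irrelevance.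
Qed.

Definition ring_aut_one (R : pzRingType) : ring_aut R :=
  @RingAut R (@idfun R : {rmorphism R -> R}) (Bijective (frefl _) (frefl _)).

Definition ring_aut_mul (R : pzRingType) (a b : ring_aut R) : ring_aut R :=
  @RingAut R (a \o b : {rmorphism R -> R})
    (bij_comp (ring_aut_bij a) (ring_aut_bij b)).

Fact ring_aut_inv_subproof (R : pzRingType) (a : ring_aut R) :
  exists b : ring_aut R, cancel a b /\ cancel b a.
Proof.
have [b ab ba] := ring_aut_bij a.
pose bD := GRing.isZmodMorphism.Build R R b (can2_zmod_morphism ab ba).
pose bM := GRing.isMonoidMorphism.Build R R b (can2_monoid_morphism ab ba).
pose bR : {rmorphism R -> R} := HB.pack b bD bM.
by exists (@RingAut R bR (Bijective ba ab)).
Qed.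

Definition ring_aut_inv (R : pzRingType) (a : ring_aut R) : ring_aut R :=
  projT1 (cid (ring_aut_inv_subproof a)).

Fact ring_aut_mulA (R : pzRingType) : associative (@ring_aut_mul R).
Proof. by move=> a b c; apply: ring_aut_eq. Qed.

Fact ring_aut_mul1g (R : pzRingType) :
  left_id (ring_aut_one R) (@ring_aut_mul R).
Proof. by move=> a; apply: ring_aut_eq. Qed.

Fact ring_aut_mulg1 (R : pzRingType) :
  right_id (ring_aut_one R) (@ring_aut_mul R).
Proof. by move=> a; apply: ring_aut_eq. Qed.

Fact ring_aut_mulVg (R : pzRingType) :
  left_inverse (ring_aut_one R) (@ring_aut_inv R) (@ring_aut_mul R).
Proof.
move=> a; apply: ring_aut_eq => x /=.
by rewrite /ring_aut_inv; case: cid => b [ab _] /=; rewrite ab.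
Qed.

Fact ring_aut_mulgV (R : pzRingType) :
  right_inverse (ring_aut_one R) (@ring_aut_inv R) (@ring_aut_mul R).
Proof.
move=> a; apply: ring_aut_eq => x /=.
by rewrite /ring_aut_inv; case: cid => b [_ ba] /=; rewrite ba.
Qed.

HB.instance Definition _ (R : pzRingType) := isGroup.Build (ring_aut R)
  (@ring_aut_mulA R) (@ring_aut_mul1g R) (@ring_aut_mulg1 R)
  (@ring_aut_mulVg R) (@ring_aut_mulgV R).

(* Additive extension to formal sums of the map r g |-> F g r on terms; it has
   the prescribed values on terms when each F g is additive. *)

Definition malg_ext (K : choiceType) (U V : zmodType) (F : K -> U -> V)
    (x : {malg U[K]}) : V :=
  \sum_(k <- msupp x) F k x@_k.

Lemma zmod_morphism0 (U V : zmodType) (f : U -> V) :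
  zmod_morphism f -> f 0 = 0.
Proof. by move=> fB; rewrite -[X in f X](subrr 0) fB subrr. Qed.

Lemma malg_extU (K : choiceType) (U V : zmodType) (F : K -> U -> V) k u :
  (forall k, zmod_morphism (F k)) -> malg_ext F << u *g k >> = F k u.
Proof.
move=> FB; rewrite /malg_ext msuppU; case: eqVneq => [->|_].
  by rewrite big_seq_fset0 zmod_morphism0.
by rewrite big_seq_fset1 mcoeffUU.
Qed.

Lemma malg_ext_is_zmod_morphism (K : choiceType) (U V : zmodType)
  (F : K -> U -> V) :
  (forall k, zmod_morphism (F k)) -> zmod_morphism (malg_ext F).
Proof.
move=> FB x y.
have F0 k : F k 0 = 0 by apply: zmod_morphism0.
pose D := (msupp x `|` msupp y)%fset.
have extE z : (msupp z `<=` D)%fset -> malg_ext F z = \sum_(k <- D) F k z@_k.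
  move=> zD; rewrite /malg_ext (big_fset_incl _ zD) // => k _ kz.
  by rewrite mcoeff_outdom.
rewrite !extE ?fsubsetUl ?fsubsetUr ?msuppB_le // -sumrB.
by apply: eq_bigr => k _; rewrite mcoeffB FB.
Qed.

Lemma malg_zmod_morphism_eq (K : choiceType) (U V : zmodType)
  (f g : {malg U[K]} -> V) : zmod_morphism f -> zmod_morphism g ->
  (forall k u, f << u *g k >> = g << u *g k >>) -> f =1 g.
Proof.
move=> fB gB fg x.
pose fA : {additive _ -> _} := HB.pack f (GRing.isZmodMorphism.Build _ _ f fB).
pose gA : {additive _ -> _} := HB.pack g (GRing.isZmodMorphism.Build _ _ g gB).
rewrite [x]monalgE -[f]/(fA : _ -> _) -[g]/(gA : _ -> _) !raddf_sum.
by apply: eq_bigr => k _; apply: fg.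
Qed.

(* An alias of the finite formal sums [{malg R[G]}], where [<< r *g g >>] is the
   term r g, to carry the multiplication twisted by theta. *)

Definition twisted_group_ring (R : pzRingType) (G : groupType)
  (theta : group_hom G (ring_aut R)) : Type := {malg R[G]}.

HB.instance Definition _ (R : pzRingType) (G : groupType)
  (theta : group_hom G (ring_aut R)) :=
  GRing.Zmodule.on (twisted_group_ring theta).

Definition twist_one (R : pzRingType) (G : groupType)
    (theta : group_hom G (ring_aut R)) : twisted_group_ring theta :=
  << 1 *g 1%g >>.

Definition twist_mul (R : pzRingType) (G : groupType)
    (theta : group_hom G (ring_aut R)) (x y : twisted_group_ring theta) :
    twisted_group_ring theta :=
  malg_ext (fun g1 r1 =>
    malg_ext (fun g2 r2 => << r1 * theta g1 r2 *g (g1 * g2)%g >>) y) x.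


Fact twist_term_is_zmod_morphism (R : pzRingType) (G : groupType)
  (theta : group_hom G (ring_aut R)) (g1 g2 : G) (r1 : R) :
  zmod_morphism (fun r2 => << r1 * theta g1 r2 *g (g1 * g2)%g >>
                   : twisted_group_ring theta).
Proof. by move=> r s /=; rewrite rmorphB mulrBr monalgUB. Qed.

Fact twist_mulBr (R : pzRingType) (G : groupType)
  (theta : group_hom G (ring_aut R)) (x : twisted_group_ring theta) :
  zmod_morphism (twist_mul x).
Proof.
move=> y z; rewrite /twist_mul /malg_ext -sumrB; apply: eq_bigr => g1 _.
exact: (malg_ext_is_zmod_morphism
  (fun g2 => twist_term_is_zmod_morphism theta g1 g2 x@_g1)).
Qed.

Fact twist_mulBl (R : pzRingType) (G : groupType)
  (theta : group_hom G (ring_aut R)) (y : twisted_group_ring theta) :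
  zmod_morphism (fun x => twist_mul x y).
Proof.
apply: malg_ext_is_zmod_morphism => g1 r s; rewrite /malg_ext -sumrB.
by apply: eq_bigr => g2 _; rewrite mulrBl monalgUB.
Qed.

Lemma twist_mulU (R : pzRingType) (G : groupType)
  (theta : group_hom G (ring_aut R)) (r1 r2 : R) (g1 g2 : G) :
  twist_mul (<< r1 *g g1 >> : twisted_group_ring theta) << r2 *g g2 >> =
  << r1 * theta g1 r2 *g (g1 * g2)%g >>.
Proof.
rewrite /twist_mul malg_extU.
  by rewrite malg_extU // => g; apply: twist_term_is_zmod_morphism.
move=> g r s; rewrite /malg_ext -sumrB.
by apply: eq_bigr => h _; rewrite mulrBl monalgUB.
Qed.

Fact twist_mulA (R : pzRingType) (G : groupType)
  (theta : group_hom G (ring_aut R)) : associative (@twist_mul R G theta).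
Proof.
move=> x y z; move: x; apply: malg_zmod_morphism_eq.
- exact: twist_mulBl.
- by move=> x x'; rewrite !twist_mulBl.
move=> g1 r1; move: y; apply: malg_zmod_morphism_eq.
- by move=> y y'; rewrite twist_mulBl twist_mulBr.
- by move=> y y'; rewrite twist_mulBr twist_mulBl.
move=> g2 r2; move: z; apply: malg_zmod_morphism_eq.
- by move=> z z'; rewrite !twist_mulBr.
- exact: twist_mulBr.
move=> g3 r3; rewrite !twist_mulU gmulfM /=.
by rewrite rmorphM mulrA mulgA.
Qed.

Fact twist_mul1r (R : pzRingType) (G : groupType)
  (theta : group_hom G (ring_aut R)) :
  left_id (twist_one theta) (@twist_mul R G theta).
Proof.
apply: malg_zmod_morphism_eq => [||g r]; [exact: twist_mulBr|by []|].
by rewrite twist_mulU gmulf1 mul1r mul1g.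
Qed.

Fact twist_mulr1 (R : pzRingType) (G : groupType)
  (theta : group_hom G (ring_aut R)) :
  right_id (twist_one theta) (@twist_mul R G theta).
Proof.
apply: malg_zmod_morphism_eq => [||g r]; [exact: twist_mulBl|by []|].
by rewrite twist_mulU rmorph1 mulr1 mulg1.
Qed.

Fact twist_mulDl (R : pzRingType) (G : groupType)
  (theta : group_hom G (ring_aut R)) :
  left_distributive (@twist_mul R G theta) +%R.
Proof.
move=> x y z; apply: (canRL (subrK _)); rewrite -twist_mulBl.
by rewrite addrK.
Qed.

Fact twist_mulDr (R : pzRingType) (G : groupType)
  (theta : group_hom G (ring_aut R)) :
  right_distributive (@twist_mul R G theta) +%R.
Proof.
move=> x y z; apply: (canRL (subrK _)); rewrite -twist_mulBr.
by rewrite addrK.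
Qed.

HB.instance Definition _ (R : pzRingType) (G : groupType)
  (theta : group_hom G (ring_aut R)) :=
  GRing.Zmodule_isPzRing.Build (twisted_group_ring theta)
    (@twist_mulA R G theta) (@twist_mul1r R G theta) (@twist_mulr1 R G theta)
    (@twist_mulDl R G theta) (@twist_mulDr R G theta).

Definition twist_incl (R : pzRingType) (G : groupType)
    (theta : group_hom G (ring_aut R)) (r : R) : twisted_group_ring theta :=
  << r *g 1%g >>.

Fact twist_incl_is_zmod_morphism (R : pzRingType) (G : groupType)
  (theta : group_hom G (ring_aut R)) : zmod_morphism (twist_incl theta).
Proof. by move=> r s; rewrite /twist_incl monalgUB. Qed.

Fact twist_incl_is_monoid_morphism (R : pzRingType) (G : groupType)
  (theta : group_hom G (ring_aut R)) : GRing.monoid_morphism (twist_incl theta).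
Proof.
split=> // r s; rewrite [RHS]twist_mulU.
by rewrite gmulf1 mulg1.
Qed.

HB.instance Definition _ (R : pzRingType) (G : groupType)
  (theta : group_hom G (ring_aut R)) :=
  GRing.isZmodMorphism.Build R (twisted_group_ring theta) (twist_incl theta)
    (twist_incl_is_zmod_morphism theta).
HB.instance Definition _ (R : pzRingType) (G : groupType)
  (theta : group_hom G (ring_aut R)) :=
  GRing.isMonoidMorphism.Build R (twisted_group_ring theta) (twist_incl theta)
    (twist_incl_is_monoid_morphism theta).

Definition twist_obj (R : pzRingType)
    (theta : slice Grp (ring_aut R)) : coslice Ring R :=
  @CosliceObj Ring R (twisted_group_ring (slice_map theta))
    (twist_incl (slice_map theta)).

(* Main.v *)
Require Import Defs.
From HB Require Import structures.
From mathcomp Require Import all_boot all_algebra.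
From mathcomp Require Import finmap.
From mathcomp Require Import boolp.
From mathcomp.multinomials Require Import monalg.

(** A morphism [j] over [Aut R] acts on twisted group rings by relabelling the
    group elements, [r g |-> r (j g)]. The one point with content is
    multiplicativity. On terms, the image of [(r1 g1) (r2 g2)] is
    [r1 (theta_g1 r2) j (g1 g2)], while the product of the images is
    [r1 (psi_(j g1) r2) (j g1) (j g2)]; they agree because [j] is a
    homomorphism and [psi \o j = theta], which is exactly the commutation of the
    triangle defining a morphism of the slice category ([twist_fun_is_monoid_morphism]).
    Everything else reduces to terms as well: products are biadditive, and an
    additive map on formal sums is determined by its values on terms
    ([malg_zmod_morphism_eq]). In particular a homomorphism out of a twisted
    group ring is determined by its values on terms ([twist_coslice_hom_eq]),
    and on terms functoriality reads [id g = g] and [(j \o i) g = j (i g)]. *)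

Set Implicit Arguments.
Unset Strict Implicit.
Unset Printing Implicit Defensive.

Import GRing.Theory.
Local Open Scope ring_scope.

Section TwistFun.

Variables (R : pzRingType) (G K : groupType).
Variables (theta : group_hom G (ring_aut R)) (psi : group_hom K (ring_aut R)).
Variable j : group_hom G K.

Definition twist_fun (x : twisted_group_ring theta) : twisted_group_ring psi :=
  malg_ext (fun g r => << r *g j g >>) x.

Lemma relabel_term_is_zmod_morphism (g : G) :
  zmod_morphism (fun r : R => << r *g j g >> : {malg R[K]}).
Proof. by move=> r s; rewrite monalgUB. Qed.

Lemma twist_funU (r : R) (g : G) : twist_fun << r *g g >> = << r *g j g >>.
Proof. exact: (malg_extU g r relabel_term_is_zmod_morphism). Qed.

Lemma twist_fun_is_zmod_morphism : zmod_morphism twist_fun.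
Proof. exact: malg_ext_is_zmod_morphism relabel_term_is_zmod_morphism. Qed.

Hypothesis psi_j : forall g, psi (j g) = theta g.

(** Both sides of multiplicativity are biadditive, so it is a statement about
    two terms, where the twists [theta g] and [psi (j g)] have to agree. *)
Lemma twist_fun_is_monoid_morphism : GRing.monoid_morphism twist_fun.
Proof.
split=> [|x y]; first by rewrite [LHS]twist_funU monoid.gmulf1.
have funB := twist_fun_is_zmod_morphism.
rewrite -[RHS]/(twist_mul (twist_fun x) (twist_fun y)).
rewrite -[x * y]/(twist_mul x y).
move: x; apply: malg_zmod_morphism_eq.
- by move=> x x'; rewrite twist_mulBl funB.
- by move=> x x'; rewrite funB twist_mulBl.
move=> g1 r1; move: y; apply: malg_zmod_morphism_eq.
- by move=> y y'; rewrite twist_mulBr funB.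
- by move=> y y'; rewrite funB twist_mulBr.
move=> g2 r2.
by rewrite twist_mulU !twist_funU twist_mulU psi_j monoid.gmulfM.
Qed.

Definition twist_rmorphism :
    {rmorphism twisted_group_ring theta -> twisted_group_ring psi} :=
  HB.pack twist_fun
    (GRing.isZmodMorphism.Build _ _ twist_fun twist_fun_is_zmod_morphism)
    (GRing.isMonoidMorphism.Build _ _ twist_fun twist_fun_is_monoid_morphism).

End TwistFun.

Section Twist.

Variable R : pzRingType.

Lemma slice_commE (theta psi : slice Grp (ring_aut R)) (j : chom theta psi) g :
  slice_map psi (slice_mor j g) = slice_map theta g.
Proof. by rewrite -(slice_comm j). Qed.

Lemma twist_rmorphism_incl (theta psi : slice Grp (ring_aut R))
    (j : chom theta psi) :
  @compm Ring _ _ _ (twist_rmorphism (slice_commE j))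
      (coslice_map (twist_obj theta)) =
    coslice_map (twist_obj psi).
Proof.
by apply: rmorphism_eq => r; rewrite [LHS]twist_funU monoid.gmulf1.
Qed.

Definition twist_mor (theta psi : slice Grp (ring_aut R)) (j : chom theta psi) :
    chom (twist_obj theta) (twist_obj psi) :=
  @CosliceHom Ring R (twist_obj theta) (twist_obj psi) _
    (twist_rmorphism_incl j).

Lemma twist_morU (theta psi : slice Grp (ring_aut R)) (j : chom theta psi)
    (r : R) (g : slice_dom theta) :
  coslice_mor (twist_mor j) << r *g g >> = << r *g slice_mor j g >>.
Proof. exact: twist_funU. Qed.

Lemma twist_coslice_hom_eq (theta : slice Grp (ring_aut R))
    (B : coslice Ring R) (f g : chom (twist_obj theta) B) :
  (forall (h : slice_dom theta) (r : R),
    coslice_mor f << r *g h >> = coslice_mor g << r *g h >>) -> f = g.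
Proof.
move=> fg; apply: coslice_hom_eq; apply: rmorphism_eq.
pose S : pzRingType := coslice_cod B.
have morB (k : {rmorphism twisted_group_ring (slice_map theta) -> S}) :
  zmod_morphism k by exact: rmorphB.
exact: (@malg_zmod_morphism_eq _ R S _ _ (morB _) (morB _) fg).
Qed.

Lemma twist_mor_is_functor : is_functor twist_mor.
Proof.
split=> [theta|theta psi chi j i]; apply: twist_coslice_hom_eq => g r.
  by rewrite twist_morU.
by rewrite twist_morU /= !twist_funU.
Qed.

End Twist.

Theorem proposition3p4 (R : pzRingType) :
  exists twist_mor : forall theta psi : slice Grp (ring_aut R),
      chom theta psi -> chom (twist_obj theta) (twist_obj psi),
    is_functor twist_mor /\
    forall (theta psi : slice Grp (ring_aut R)) (j : chom theta psi)
        (r : R) (g : slice_dom theta),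
      coslice_mor (twist_mor theta psi j) << r *g g >> =
        << r *g slice_mor j g >>.
Proof.
exists (@twist_mor R); split; first exact: twist_mor_is_functor.
exact: twist_morU.
Qed.
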